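(* Given a reduced tree automaton $\mathcal{A}$ over $\Sigma$, it is decidable whether the tree language $L$ recognised by $\mathcal{A}$ is slim or fat. Moreover, if $L$ is slim, then $L\subseteq T^{2^{n-1}}_\Sigma$, where $n$ is the number of states of $\mathcal{A}$.
   Context: A tree domain is a non-empty finite prefix-closed set $D\subseteq\{0,1\}^\star$ such that for every $u\in D$: $u0\in D$ iff $u1\in D$. A tree over a finite alphabet $\Sigma$ is a map $t\colon D\to\Sigma$ with $\operatorname{dom}(t)=D$ a tree domain; $T_\Sigma$ is the set of all trees. The thickness of $t$ is $\max_{\ell\ge 0}|\operatorname{dom}(t)\cap\{0,1\}^\ell|$; $T^K_\Sigma$ is the set of trees of thickness at most $K$. A language $L\subseteq T_\Sigma$ is slim if $L\subseteq T^K_\Sigma$ for some $K\ge1$, and fat otherwise. A (deterministic bottom-up) tree automaton is $\mathcal{A}=(Q,\iota,\delta,F)$ with finite $Q$, $\iota\colon\Sigma\to Q$, $\delta\colon\Sigma\times Q\times Q\to Q$, $F\subseteq Q$; $\mathcal{A}(t)=\iota(t(\epsilon))$ if $\operatorname{dom}(t)=\{\epsilon\}$ and $\mathcal{A}(t)=\delta(t(\epsilon),\mathcal{A}(t\restriction0),\mathcal{A}(t\restriction1))$ otherwise, where $t\restriction u$ is the subtree $v\mapsto t(uv)$; it recognises $\{t:\mathcal{A}(t)\in F\}$. $\mathcal{A}$ is reduced if for every $q\in Q$ there is a tree $t$ with $\mathcal{A}(t)=q$. *)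

(* Defs.v *)
From HB Require Import structures.
From mathcomp Require Import all_boot finmap.

Set Implicit Arguments.
Unset Strict Implicit.
Unset Printing Implicit Defensive.

Local Open Scope fset_scope.
Local Open Scope fmap_scope.

(* Words over {0,1} are boolean sequences: 0 is [false] and 1 is [true]. *)
Definition word := seq bool.

Definition is_tree_domain (D : {fset word}) : bool :=
  [&& D != fset0,
      [forall u : D, [forall k : 'I_(size (val u)), take k (val u) \in D]] &
      [forall u : D, (rcons (val u) false \in D) == (rcons (val u) true \in D)]].

Lemma tree_domainP (D : {fset word}) :
  reflect [/\ D <> fset0,
              forall u v : word, u ++ v \in D -> u \in D &
              forall u : word, u \in D ->
                (rcons u false \in D <-> rcons u true \in D)]
          (is_tree_domain D).
Proof.
apply: (iffP and3P) => -[D0 Dp Db]; split.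
- exact/eqP.
- move=> u v uvD.
  have [v0|v0] := eqVneq v [::]; first by rewrite v0 cats0 in uvD.
  have ltu : size u < size (u ++ v).
    by rewrite size_cat -[ltnLHS]addn0 ltn_add2l lt0n size_eq0.
  move/forallP: Dp => /(_ [` uvD]) /forallP /(_ (Ordinal ltu)) /=.
  by rewrite take_size_cat.
- by move=> u uD; move/forallP: Db => /(_ [` uD]) /eqP /= ->.
- exact/eqP.
- apply/forallP => -[u uD]; apply/forallP => k /=.
  by apply: (Dp _ (drop k u)); rewrite cat_take_drop.
- apply/forallP => -[u uD] /=; have [D01 D10] := Db u uD; apply/eqP.
  by apply/idP/idP.
Qed.

Section Trees.
Variable Sigma : finType.

Record tree := Tree {
  tree_map :> {fmap word -> Sigma};
  _ : is_tree_domain (domf tree_map)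
}.
HB.instance Definition _ := [isSub for tree_map].

Implicit Types (t : tree) (u v : word).

Definition dom t : {fset word} := domf (tree_map t).

Lemma dom_tree t : is_tree_domain (dom t).
Proof. exact: (valP t). Qed.

Lemma dom_prefix t u v : u ++ v \in dom t -> u \in dom t.
Proof. by have /tree_domainP[_ + _] := dom_tree t; apply. Qed.

Lemma dom_nil t : [::] \in dom t.
Proof.
have /tree_domainP[/eqP/fset0Pn[u uD] _ _] := dom_tree t.
exact: (@dom_prefix t [::] u).
Qed.

Definition root_label t : Sigma := (tree_map t).[dom_nil t].

(* The finite map v |-> t(uv). *)
Definition subtree_map t u : {fmap word -> Sigma} :=
  reducef [fmap v : [fset drop (size u) w | w in dom t] =>
             (tree_map t).[? u ++ val v]].

Lemma subtree_mapE t u v : (subtree_map t u).[? v] = (tree_map t).[? u ++ v].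
Proof.
rewrite fnd_reducef; case: fndP => [vD|vD] /=; first by rewrite ffunE.
case: fndP => // uvD; case/negP: vD => /=.
by apply/imfsetP; exists (u ++ v); rewrite // drop_size_cat.
Qed.

Lemma mem_subtree_map t u v : (v \in domf (subtree_map t u)) = (u ++ v \in dom t).
Proof.
have := fndSome (subtree_map t u) v; rewrite subtree_mapE => <-.
exact: fndSome.
Qed.

Lemma subtree_map_domain t u :
  u \in dom t -> is_tree_domain (domf (subtree_map t u)).
Proof.
have /tree_domainP[_ Dp Db] := dom_tree t.
move=> uD; apply/tree_domainP; split.
- by apply/eqP/fset0Pn; exists [::]; rewrite mem_subtree_map cats0.
- by move=> v w; rewrite !mem_subtree_map catA; apply: Dp.
- by move=> v; rewrite !mem_subtree_map -!rcons_cat; apply: Db.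
Qed.

(* For u outside [dom t], where the subtree is undefined, the value is t. *)
Definition subtree t u : tree := insubd t (subtree_map t u).

Lemma subtreeE t u v :
  u \in dom t -> (tree_map (subtree t u)).[? v] = (tree_map t).[? u ++ v].
Proof.
by move=> uD; rewrite -subtree_mapE [tree_map _]insubdK //; apply: subtree_map_domain.
Qed.

Lemma mem_subtree t u v :
  u \in dom t -> (v \in dom (subtree t u)) = (u ++ v \in dom t).
Proof.
move=> uD; have := fndSome (subtree t u) v; rewrite subtreeE // => <-.
exact: fndSome.
Qed.

Definition level t (l : nat) : {fset word} := [fset u in dom t | size u == l].

(* Levels beyond the longest word of [dom t] are empty, see [level_thickness]. *)
Definition thickness t : nat := \max_(u : dom t) #|` level t (size (val u))|.

Lemma level_thickness t l : #|` level t l| <= thickness t.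
Proof.
have [->|/fset0Pn[u]] := eqVneq (level t l) fset0; first by rewrite cardfs0.
rewrite !inE /= => /andP[uD /eqP <-].
exact: (leq_bigmax [` uD]).
Qed.

Definition language := tree -> Prop.

Definition thickness_at_most (K : nat) : language := fun t => thickness t <= K.

Definition slim (L : language) : Prop :=
  exists2 K : nat, 1 <= K & forall t, L t -> thickness_at_most K t.

Definition fat (L : language) : Prop := ~ slim L.

End Trees.

Record tree_automaton (Sigma Q : finType) := TreeAutomaton {
  init : Sigma -> Q;
  trans : Sigma -> Q -> Q -> Q;
  final : {set Q}
}.

Section Runs.
Variables (Sigma Q : finType) (A : tree_automaton Sigma Q).
Implicit Type t : tree Sigma.

Fixpoint run_fuel (k : nat) t : Q :=
  if dom t == [fset [::]] then init A (root_label t) else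
  if k is k'.+1 then
    trans A (root_label t) (run_fuel k' (subtree t [:: false]))
                           (run_fuel k' (subtree t [:: true]))
  else init A (root_label t).

(* The fuel always suffices: [run] obeys the recursive equations [run_leaf]
   and [run_node], which determine it. *)
Definition run t : Q := run_fuel #|` dom t| t.

Lemma dom_child t b : dom t <> [fset [::]] -> [:: b] \in dom t.
Proof.
have /tree_domainP[_ Dp Db] := dom_tree t => tN.
have [c cD] : exists c, [:: c] \in dom t.
  have /fset0Pn[[|c u]] : dom t `\ [::] != fset0.
  - apply/eqP => D0; apply: tN; apply/eqP.
    by rewrite eqEfsubset -fsetD_eq0 D0 eqxx fsub1set dom_nil.
  - by rewrite !inE.
  by rewrite !inE /= => uD; exists c; apply: (Dp [:: c] u).
have := Db [::] (dom_nil t); rewrite /=.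
by case: b c cD => -[] // cD H; apply/H.
Qed.

Lemma card_subtree t b :
  [:: b] \in dom t -> #|` dom (subtree t [:: b])| < #|` dom t|.
Proof.
move=> bD; rewrite [ltnRHS](cardfsD1 [::]) dom_nil ltnS.
have -> : #|` dom (subtree t [:: b])| =
          #|` [fset b :: v | v in dom (subtree t [:: b])]|.
  by rewrite card_imfset // => v w [].
apply/fsubset_leq_card/fsubsetP => u /imfsetP[v /= vD ->].
by move: vD; rewrite mem_subtree // !inE.
Qed.

Lemma run_fuel_eq j k t :
  #|` dom t| <= j -> #|` dom t| <= k -> run_fuel j t = run_fuel k t.
Proof.
have dom_gt0 s : 0 < #|` dom s|.
  by rewrite cardfs_gt0; apply/fset0Pn; exists [::]; apply: dom_nil.
elim: j k t => [|j IH] [|k] t; try by rewrite leqNgt dom_gt0.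
  by move=> _; rewrite leqNgt dom_gt0.
move=> tj tk /=; case: (dom t =P _) => // tN.
have lt_sub b := card_subtree (dom_child b tN).
by rewrite !(IH k) // -ltnS; apply: leq_trans (lt_sub _) _.
Qed.

Lemma run_fuelE k t : #|` dom t| <= k -> run_fuel k t = run t.
Proof. by move=> tk; apply: run_fuel_eq. Qed.

Lemma run_leaf t : dom t = [fset [::]] -> run t = init A (root_label t).
Proof. by rewrite /run => tL; case: #|` _| => [|k] /=; rewrite tL eqxx. Qed.

Lemma run_node t : dom t <> [fset [::]] ->
  run t = trans A (root_label t) (run (subtree t [:: false]))
                                 (run (subtree t [:: true])).
Proof.
move=> tN; rewrite -(@run_fuelE #|` dom t|.+1) //=; case: eqP => // _.
by rewrite !run_fuelE // ltnW // card_subtree //; apply: dom_child.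
Qed.

Definition recognised : language Sigma := fun t => run t \in final A.

Definition reduced : Prop := forall q : Q, exists t, run t = q.

(* The automaton as a flat list of numbers, letters and states being numbered
   by their rank in the enumeration of their type: sizes of the alphabet and
   of the state set, then the tables of [init], [trans] and [final]. *)
Definition automaton_table : seq nat :=
  [:: #|Sigma|; #|Q|]
  ++ [seq val (enum_rank (init A a)) | a <- enum Sigma]
  ++ [seq val (enum_rank (trans A a qr.1 qr.2))
        | a <- enum Sigma, qr <- [seq (q, r) | q <- enum Q, r <- enum Q]]
  ++ [seq nat_of_bool (q \in final A) | q <- enum Q].

Definition automaton_code : nat := CodeSeq.code automaton_table.

End Runs.

(* Kleene's mu-recursive functions; [recfun n] is the type of descriptions of
   n-ary partial recursive functions on the natural numbers. *)
Inductive recfun : nat -> Type :=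
| RZero n : recfun n
| RSucc : recfun 1
| RProj n (i : 'I_n) : recfun n
| RComp m n (g : recfun m) (h : 'I_m -> recfun n) : recfun n
| RPrim n (g : recfun n) (h : recfun n.+2) : recfun n.+1
| RMin n (g : recfun n.+1) : recfun n.

(* [computes f v y]: the partial function f is defined at v, with value y. *)
Fixpoint computes n (f : recfun n) : n.-tuple nat -> nat -> Prop :=
  match f in recfun n return n.-tuple nat -> nat -> Prop with
  | RZero _ => fun _ y => y = 0
  | RSucc => fun v y => y = (thead v).+1
  | RProj _ i => fun v y => y = tnth v i
  | RComp m _ g h => fun v y =>
      exists2 w : m.-tuple nat,
        forall i, computes (h i) v (tnth w i) & computes g w y
  | RPrim _ g h => fun v =>
      let xs := [tuple of behead v] in
      (fix iter (k : nat) (y : nat) : Prop :=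
         if k is k'.+1 then
           exists2 z, iter k' z & computes h [tuple of k' :: z :: xs] y
         else computes g xs y) (thead v)
  | RMin _ g => fun v y =>
      (forall i, i < y -> exists z, computes g [tuple of i :: v] z.+1)
      /\ computes g [tuple of y :: v] 0
  end.

Lemma computes_fun n (f : recfun n) v y z :
  computes f v y -> computes f v z -> y = z.
Proof.
elim: f v y z => {n} /=.
- by move=> n v y z -> ->.
- by move=> v y z -> ->.
- by move=> n i v y z -> ->.
- move=> m n g IHg h IHh v y z [w wP gy] [w' wP' gz].
  have ww' : w = w' by apply: eq_from_tnth => i; apply: IHh (wP i) (wP' i).
  by rewrite -ww' in gz; apply: IHg gy gz.
- move=> n g IHg h IHh v; elim: (thead v) => [|k IHk] y z; first exact: IHg.
  move=> [y' ky hy] [z' kz hz].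
  by rewrite -(IHk _ _ ky kz) in hz; apply: IHh hy hz.
- move=> n g IHg v y z [yP gy] [zP gz].
  case: (ltngtP y z) => // [/zP|/yP] [x gx].
  + by have := IHg _ _ _ gy gx.
  + by have := IHg _ _ _ gz gx.
Qed.

(* Main.v *)
(* Call a state unbounded if it lies above a cycle of the child-to-parent step
   relation, i.e. has arbitrarily tall trees.  The language is fat iff some
   productive state r has a transition r = delta(a, x, y), up to order, with x on
   a common cycle with r and y unbounded.  Pumping the cycle stacks tall siblings
   and makes levels arbitrarily wide.  Otherwise, let rank q count the states
   strictly below q; every level of a tree evaluating to a productive q has at
   most 2 ^ rank q nodes: a child in the component of q has a sibling of smaller
   height than rank q, and if no child is in it both children have smaller rank.
   This criterion is decidable by bounded quantification over the table of the
   automaton. *)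
Require Import Defs.
From mathcomp Require Import all_boot finmap zify.

Set Implicit Arguments.
Unset Strict Implicit.
Unset Printing Implicit Defensive.

Local Open Scope fset_scope.
Local Open Scope fmap_scope.
Local Open Scope nat_scope.

(** * Levels of trees *)

Section TreeShape.
Variable Sigma : finType.
Implicit Type t : tree Sigma.

Definition is_leaf t : bool := dom t == [fset [::]].

Lemma tree_ind_subtree (P : tree Sigma -> Prop) :
  (forall t, (~~ is_leaf t -> forall b, P (subtree t [:: b])) -> P t) ->
  forall t, P t.
Proof.
move=> IH t; have [n] := ubnP #|` dom t|; elim: n t => // n IHn t tn.
apply: IH => tN b; apply: IHn; rewrite -ltnS; apply: leq_trans tn; rewrite ltnS.
by apply/card_subtree/dom_child/eqP.
Qed.

Lemma level0 t : #|` level t 0| = 1.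
Proof.
rewrite -(cardfs1 ([::] : word)); congr #|` _|; apply/fsetP => u.
rewrite !inE /= size_eq0 andbC; case: eqP => // ->.
by rewrite dom_nil.
Qed.

Lemma level_leaf t l : is_leaf t -> #|` level t l.+1| = 0.
Proof.
move=> /eqP tL; apply/eqP; rewrite cardfs_eq0; apply/eqP/fsetP => u.
by rewrite !inE /= tL inE; case: eqP => // ->.
Qed.

(** Sorting words of length [l.+1] by their first letter gives two disjoint parts; prepending a
    fixed letter is injective, so each part is a copy of level [l] of one child. *)
Lemma level_node t l : ~~ is_leaf t ->
  #|` level t l.+1| =
  #|` level (subtree t [:: false]) l| + #|` level (subtree t [:: true]) l|.
Proof.
move=> /eqP tN.
have fibre b : exists2 D : {fset word}, #|` D| = #|` level (subtree t [:: b]) l| &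
    forall u, (u \in D) = [&& u \in dom t, ohead u == Some b & size u == l.+1].
  exists [fset b :: v | v in level (subtree t [:: b]) l].
    by rewrite card_imfset // => v w [].
  move=> u; apply/imfsetP/and3P => [[v /=]|[]].
    by rewrite !inE /= mem_subtree ?dom_child // => /andP[? ?] ->; split.
  case: u => //= c v vD /eqP[cb] vl; subst c; exists v => //=.
  by rewrite !inE /= mem_subtree ?dom_child //= vD.
have [D0 card0 mem0] := fibre false; have [D1 card1 mem1] := fibre true.
transitivity (#|` D0| + #|` D1|); last by rewrite card0 card1.
rewrite -cardfsUI (_ : D0 `&` D1 = fset0).
  rewrite cardfs0 addn0; congr #|` _|; apply/fsetP => u.
  by rewrite !inE mem0 mem1; case: u => [|[] u] /=; rewrite ?andbF ?orbF.
by apply/fsetP => u; rewrite !inE mem0 mem1; case: u => [|[] u]; rewrite ?andbF.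
Qed.

Lemma level_leq_exp t l : #|` level t l| <= 2 ^ l.
Proof.
elim: l t => [|l IH] t; first by rewrite level0.
have [tL|tN] := boolP (is_leaf t); first by rewrite level_leaf.
by rewrite level_node // expnS mul2n -addnn leq_add.
Qed.

(** * Joining two trees under a new root *)

Section Node.
Variables (a : Sigma) (t0 t1 : tree Sigma).
Let child (b : bool) := if b then t1 else t0.

Definition node_map : {fmap word -> Sigma} :=
  [fmap w : [::] |` [fset false :: v | v in dom t0]
                 `|` [fset true :: v | v in dom t1]
     => if val w is b :: v then odflt a (tree_map (child b)).[? v] else a].

Lemma mem_node_map w :
  (w \in domf node_map) = if w is b :: v then v \in dom (child b) else true.
Proof.
have mem_cons b c v (D : {fset word}) :
    (b :: v \in [fset c :: u | u in D]) = (b == c) && (v \in D).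
  apply/imfsetP/andP => [[u /= uD [-> ->]]|[/eqP-> vD]]; first by rewrite eqxx.
  by exists v.
rewrite !inE /=; case: w => [|b v] //=.
by rewrite !mem_cons; case: b; rewrite ?orbF.
Qed.

Lemma node_mapE w :
  node_map.[? w] = if w is b :: v then (tree_map (child b)).[? v] else Some a.
Proof.
have := mem_node_map w; case: fndP => [wD|wD _]; last first.
  case: w wD => [|b v]; rewrite mem_node_map // => vD.
  by rewrite not_fnd.
rewrite ffunE /=; case: w wD => [|b v] // wD /esym vD.
by rewrite in_fnd.
Qed.

Lemma node_map_domain : is_tree_domain (domf node_map).
Proof.
apply/tree_domainP; split.
- by apply/eqP/fset0Pn; exists [::]; rewrite mem_node_map.
- by move=> [|b u] v; rewrite !mem_node_map //=; apply: dom_prefix.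
- move=> [|b u]; rewrite !mem_node_map /=; first by rewrite !dom_nil.
  by have /tree_domainP[_ _] := dom_tree (child b); apply.
Qed.

Definition node : tree Sigma := Tree node_map_domain.

Lemma node_not_leaf : ~~ is_leaf node.
Proof.
apply/eqP => /fsetP /(_ [:: false]).
by rewrite mem_node_map inE /= dom_nil.
Qed.

Lemma root_label_node : root_label node = a.
Proof. by rewrite /root_label ffunE. Qed.

Lemma subtree_node b : subtree node [:: b] = child b.
Proof.
have bD : [:: b] \in dom node by rewrite mem_node_map dom_nil.
by apply/val_inj/fmapP => v; rewrite subtreeE //= node_mapE.
Qed.

Lemma level_of_node l :
  #|` level node l.+1| = #|` level t0 l| + #|` level t1 l|.
Proof. by rewrite level_node ?node_not_leaf // !subtree_node. Qed.

Lemma run_of_node (Q : finType) (A : tree_automaton Sigma Q) :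
  run A node = trans A a (run A t0) (run A t1).
Proof.
by rewrite run_node ?root_label_node ?subtree_node //; apply/eqP/node_not_leaf.
Qed.
End Node.
End TreeShape.

(** * Pumping and the thickness bound *)

Section Pumping.
Variables (Sigma Q : finType) (A : tree_automaton Sigma Q).
Implicit Types (t : tree Sigma) (p q x y z : Q).

(** The sibling [x] ranges over all states; for a reduced automaton each of them is the value of a
    tree, so every step occurs in an actual tree. *)
Definition step : rel Q := fun p q =>
  [exists a, exists x, (trans A a p x == q) || (trans A a x p == q)].

Definition productive q : bool := [exists f in final A, connect step q f].

(** Since [connect] is reflexive, a first step is demanded separately: the cycle has positive
    length. *)
Definition recurrent z : bool := [exists w, step z w && connect step w z].

Definition unbounded y : bool := [exists z, recurrent z && connect step z y].

Definition fat_pattern : bool :=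
  [exists a, exists x, exists y, exists r,
    [&& (trans A a x y == r) || (trans A a y x == r), connect step r x,
        productive r & unbounded y]].

Lemma step_transl a p x : step p (trans A a p x).
Proof. by apply/existsP; exists a; apply/existsP; exists x; rewrite eqxx. Qed.

Lemma step_transr a p x : step p (trans A a x p).
Proof. by apply/existsP; exists a; apply/existsP; exists x; rewrite eqxx orbT. Qed.

Lemma productive_connect p q : connect step p q -> productive q -> productive p.
Proof.
move=> pq /existsP[f /andP[fF qf]]; apply/existsP; exists f.
by rewrite fF (connect_trans pq).
Qed.

Lemma unbounded_connect p q : connect step p q -> unbounded p -> unbounded q.
Proof.
move=> pq /existsP[z /andP[zz zp]]; apply/existsP; exists z.
by rewrite zz (connect_trans zp).
Qed.

Lemma unbounded_cycle p q : step p q -> connect step q p -> unbounded p.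
Proof.
move=> pq qp; apply/existsP; exists p; rewrite connect0 andbT.
by apply/existsP; exists q; rewrite pq.
Qed.

(** * Ranks of states and upper bounds on levels *)

Definition rank q : nat := #|[set p | connect step p q && ~~ connect step q p]|.

(** Whatever is strictly below [p] is strictly below [q], and [p] itself is counted for [q] but not
    for [p]. *)
Lemma rank_lt p q : step p q -> ~~ connect step q p -> rank p < rank q.
Proof.
move=> pq qNp; apply/proper_card/properP; split.
  apply/subsetP => x; rewrite !inE => /andP[xp pNx].
  rewrite (connect_trans xp (connect1 pq)) /=; apply: contra qNp => qx.
  exact: connect_trans qx xp.
by exists p; rewrite !inE ?connect0 // connect1.
Qed.

Lemma rank_eq p q : step p q -> connect step q p -> rank p = rank q.
Proof.
move=> /connect1 pq qp; apply: eq_card => x; rewrite !inE.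
have same u v w : connect step u v -> connect step v u ->
    connect step u w = connect step v w.
  by move=> uv vu; apply/idP/idP; apply: connect_trans.
have same' u v w : connect step u v -> connect step v u ->
    connect step w u = connect step w v.
  by move=> uv vu; apply/idP/idP => wu; apply: connect_trans wu _.
by rewrite (same p q) // (same' p q).
Qed.

(** No state is strictly below itself, so [q] is never counted; this is the source of the exponent
    in the theorem. *)
Lemma rank_bound q : rank q <= #|Q| - 1.
Proof.
rewrite -ltnS subn1 prednK; last by apply/card_gt0P; exists q.
rewrite -cardsT; apply/proper_card/properP; split; first exact: subsetT.
by exists q; rewrite !inE // connect0.
Qed.

(** No state below a bounded state lies on a cycle, so the rank drops with every step down the tree
    and the height is at most the rank of the root state. *)
Lemma level_bounded_run t l :
  ~~ unbounded (run A t) -> rank (run A t) < l -> #|` level t l| = 0.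
Proof.
elim/tree_ind_subtree: t l => t IH [|l] // qB.
have [tL|tN] := boolP (is_leaf t); first by rewrite level_leaf.
rewrite level_node // ltnS => lt_l.
have childN b : step (run A (subtree t [:: b])) (run A t) ->
    #|` level (subtree t [:: b]) l| = 0.
  move=> bt; have bB : ~~ unbounded (run A (subtree t [:: b])).
    exact: contra (unbounded_connect (connect1 bt)) qB.
  apply: IH => //; apply: leq_trans lt_l; apply: rank_lt => //.
  by apply: contra bB => tb; apply: unbounded_cycle tb.
move: childN; rewrite run_node; last exact/eqP.
move=> childN; apply/eqP; rewrite addn_eq0; apply/andP; split; apply/eqP.
- exact: childN false (step_transl _ _ _).
- exact: childN true (step_transr _ _ _).
Qed.

Lemma level_productive_run t l : ~~ fat_pattern ->
  productive (run A t) -> #|` level t l| <= 2 ^ rank (run A t).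
Proof.
move=> thin; elim/tree_ind_subtree: t l => t IH [|l] qF.
  by rewrite level0 expn_gt0.
have [tL|tN] := boolP (is_leaf t); first by rewrite level_leaf.
rewrite level_node //.
have Et := run_node A (elimN eqP tN).
set t0 := subtree t [:: false] in Et *; set t1 := subtree t [:: true] in Et *.
set a := root_label t in Et.
have s0 : step (run A t0) (run A t) by rewrite Et step_transl.
have s1 : step (run A t1) (run A t) by rewrite Et step_transr.
have IH0 : #|` level t0 l| <= 2 ^ rank (run A t0) :=
  IH tN false l (productive_connect (connect1 s0) qF).
have IH1 : #|` level t1 l| <= 2 ^ rank (run A t1) :=
  IH tN true l (productive_connect (connect1 s1) qF).
clearbody t0 t1.
(* A child on a cycle through the root state forces its sibling to have
   height at most the rank, so on each level only one summand is large. *)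
have cyc u v : step (run A u) (run A t) -> step (run A v) (run A t) ->
    (trans A a (run A u) (run A v) == run A t) ||
    (trans A a (run A v) (run A u) == run A t) ->
    #|` level u l| <= 2 ^ rank (run A u) ->
    connect step (run A t) (run A u) ->
    #|` level u l| + #|` level v l| <= 2 ^ rank (run A t).
  move=> su sv uvt IHu tu.
  have vB : ~~ unbounded (run A v).
    apply: contra thin => vU; apply/existsP; exists a.
    apply/existsP; exists (run A u); apply/existsP; exists (run A v).
    by apply/existsP; exists (run A t); rewrite uvt tu qF vU.
  have lt_v : rank (run A v) < rank (run A t).
    by apply: rank_lt => //; apply: contra vB => tv; apply: unbounded_cycle tv.
  (* Below the rank, the trivial bound [2 ^ l] for each child suffices. From the rank on, level [l]
     of the sibling is empty and [u] has the same rank as the root state. *)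
  have [lt_l|le_l] := ltnP l (rank (run A t)).
    apply: leq_trans (leq_pexp2l _ lt_l) => //.
    by rewrite expnS mul2n -addnn leq_add // level_leq_exp.
  rewrite (level_bounded_run vB) ?(leq_trans lt_v) // addn0.
  by rewrite -(rank_eq su).
have [c0|n0] := boolP (connect step (run A t) (run A t0)).
  by apply: (cyc t0 t1 s0 s1 _ IH0 c0); rewrite -Et eqxx.
have [c1|n1] := boolP (connect step (run A t) (run A t1)).
  by rewrite addnC; apply: (cyc t1 t0 s1 s0 _ IH1 c1); rewrite -Et eqxx orbT.
(* Neither child state is in the component of the root state, so both ranks are smaller and each
   child fills at most half of [2 ^ rank]. *)
have lt0 := rank_lt s0 n0; have lt1 := rank_lt s1 n1.
rewrite -(ltn_predK lt0) expnS mul2n -addnn.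
apply: (leq_add (leq_trans IH0 _) (leq_trans IH1 _));
  by rewrite leq_exp2l // -ltnS (ltn_predK lt0).
Qed.

Lemma thickness_not_fat_pattern t :
  ~~ fat_pattern -> recognised A t -> thickness_at_most (2 ^ (#|Q| - 1)) t.
Proof.
move=> thin tF; apply/bigmax_leqP => u _.
apply: leq_trans (leq_pexp2l _ (rank_bound (run A t))) => //.
(* The root state of an accepted tree is final, hence productive by the empty path. *)
apply: level_productive_run thin _; apply/existsP; exists (run A t).
by rewrite connect0 andbT.
Qed.

(** * Building tall and wide trees by pumping *)

Hypothesis reducedA : reduced A.

(** Reducedness supplies a tree for the sibling state; joining it to [t] pushes the levels of [t]
    one deeper. *)
Lemma grow_step p q : step p q -> forall t, run A t = p ->
  exists2 t', run A t' = q & forall l, #|` level t l| <= #|` level t' l.+1|.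
Proof.
move=> /existsP[a /existsP[x /orP[]/eqP<-]] t <-; have [s <-] := reducedA x.
- exists (node a t s); first by rewrite run_of_node.
  by move=> l; rewrite level_of_node leq_addr.
- exists (node a s t); first by rewrite run_of_node.
  by move=> l; rewrite level_of_node leq_addl.
Qed.

(** The shift [k] is the length of a path and is fixed before the tree; [fat_pattern_fat] relies on
    this uniformity. *)
Lemma grow_connect p q : connect step p q -> exists k, forall t, run A t = p ->
  exists2 t', run A t' = q & forall l, #|` level t l| <= #|` level t' (l + k)|.
Proof.
move=> /connectP[s sP ->] {q}; exists (size s).
elim: s p sP => [|q s IH] p /= => [_|/andP[pq /IH{}IH]] t tp.
  by exists t => // l; rewrite addn0.
have [t1 /IH[t' t'q le1] le0] := grow_step pq tp.
by exists t' => // l; rewrite addnS -addSn (leq_trans (le0 l)).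
Qed.

Lemma level_antimono t l k : 0 < #|` level t (l + k)| -> 0 < #|` level t l|.
Proof.
rewrite !cardfs_gt0 => /fset0Pn[u]; rewrite !inE /= => /andP[uD /eqP ul].
apply/fset0Pn; exists (take l u); rewrite !inE /= size_take_min ul.
rewrite (minn_idPl (leq_addr _ _)) eqxx andbT.
by rewrite (@dom_prefix _ t _ (drop l u)) ?cat_take_drop.
Qed.

Lemma unbounded_tall y h : unbounded y ->
  exists2 t, run A t = y & forall l, l <= h -> 0 < #|` level t l|.
Proof.
move=> /existsP[z /andP[/existsP[w /andP[zw wz]] zy]].
(* Moving from [z] up to [y] only pushes nodes deeper, and prefix closure then fills all shallower
   levels. *)
suff [t tz th] : exists2 t, run A t = z & 0 < #|` level t h|.
  have [k grow] := grow_connect zy; have [t' t'y le] := grow t tz.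
  exists t' => // l lh; apply: (@level_antimono t' l (h + k - l)).
  by rewrite (subnKC (leq_trans lh (leq_addr _ _))) (leq_trans th).
(* Each turn around the cycle through [z] gains at least one level. *)
elim: h => [|h [t tz th]].
  by have [t tz] := reducedA z; exists t; rewrite ?level0.
have [t1 t1w le1] := grow_step zw tz.
have [k grow] := grow_connect wz; have [t2 t2z le2] := grow t1 t1w.
exists t2 => //; apply: (@level_antimono t2 _ k).
by apply: leq_trans (le2 _); apply: leq_trans (le1 _).
Qed.

Lemma fat_pattern_fat : fat_pattern -> fat (recognised A).
Proof.
move=> /existsP[a /existsP[x /existsP[y /existsP[r]]]].
move=> /and4P[xyr rx rF yU] [K _ slimK].
have [k growx] := grow_connect rx.
(* The threshold m below which the levels may be narrow does not depend on h:
   one turn around the cycle shifts it by the fixed amount k.+1. *)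
have wide n : exists m, forall h, exists2 t, run A t = r &
    forall l, m <= l <= h -> n <= #|` level t l|.
  elim: n => [|n [m IH]].
    by exists 0 => h; have [t tr] := reducedA r; exists t.
  exists (m + k).+1 => h; have [t tr tn] := IH h.
  have [t1 t1x le1] := growx t tr.
  (* The new sibling is inhabited on every level up to [h], so it adds a node to each level that
     already has [n]. *)
  have [s sy sh] := unbounded_tall h yU.
  have ext t' : (forall l, #|` level t' l.+1| =
      #|` level t1 l| + #|` level s l|) ->
      forall l, (m + k).+1 <= l <= h -> n.+1 <= #|` level t' l|.
    move=> t'E [//|l]; rewrite ltnS => /andP[mkl lh].
    rewrite t'E -addn1 leq_add ?sh ?(ltnW lh) //.
    have kl : k <= l := leq_trans (leq_addl m k) mkl.
    have := le1 (l - k); rewrite subnK //; apply: leq_trans; apply: tn.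
    by rewrite leq_subRL // addnC mkl (leq_trans (leq_subr _ _)) // ltnW.
  case/orP: xyr => /eqP <-.
  - exists (node a t1 s); first by rewrite run_of_node t1x sy.
    by apply: ext => l; rewrite level_of_node.
  - exists (node a s t1); first by rewrite run_of_node t1x sy.
    by apply: ext => l; rewrite level_of_node addnC.
(* With [h] equal to the threshold [m], level [m] has more than [K] nodes; a path from [r] to a
   final state carries them into an accepted tree. *)
have [m /(_ m)[t tr tK]] := wide K.+1.
have /existsP[f /andP[fF rf]] := rF.
have [j growf] := grow_connect rf; have [t' t'f le'] := growf t tr.
have : recognised A t' by rewrite /recognised t'f.
move=> /slimK /(leq_trans (level_thickness t' (m + j))).
by rewrite leqNgt (leq_trans _ (le' m)) // tK // leqnn.
Qed.

End Pumping.

(** * Total computable functions *)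

Section Computability.

(* The head of the tuple is the outermost second component: below k binders the
   innermost variable is e.2, the next one e.1.2, and so on. *)
Fixpoint ctx (n : nat) : Type := if n is n'.+1 then (ctx n' * nat)%type else unit.

Fixpoint ctx_of (n : nat) (s : seq nat) : ctx n :=
  if n is n'.+1 then (ctx_of n' (behead s), head 0 s) else tt.

(** The description must have a value on every input, so this is total computability. Predicates are
    covered through the coercion of booleans to 0 and 1. *)
Definition computable n (f : ctx n -> nat) : Prop :=
  exists rf : recfun n, forall v : n.-tuple nat, computes rf v (f (ctx_of n v)).

Implicit Type n : nat.

Lemma computable_ext n (f g : ctx n -> nat) :
  f =1 g -> computable f -> computable g.
Proof. by move=> fg [rf rfP]; exists rf => v; rewrite -fg. Qed.

Lemma computable_zero n : computable (fun _ : ctx n => 0).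
Proof. by exists (RZero n). Qed.

Lemma computable_succ n f : computable f -> computable (fun e : ctx n => (f e).+1).
Proof.
move=> [rf rfP]; exists (RComp RSucc (fun=> rf)) => v.
by exists [tuple f (ctx_of n v)] => // i; rewrite [i]ord1.
Qed.

Lemma computable_const n k : computable (fun _ : ctx n => k).
Proof. by elim: k => [|k /computable_succ]; first exact: computable_zero. Qed.

Lemma computable_var0 n : computable (fun e : ctx n.+1 => e.2).
Proof.
by exists (RProj ord0) => v /=; rewrite (tnth_nth 0) /= nth0.
Qed.

Lemma computable_weak n f : computable f -> computable (fun e : ctx n.+1 => f e.1).
Proof.
move=> [rf rfP]; exists (RComp rf (fun i => RProj (lift ord0 i))) => v.
exists [tuple of behead v] => [i|]; last exact: rfP.
by rewrite /= !(tnth_nth 0) /= nth_behead.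
Qed.

Lemma computable_weak_under n (f : ctx n.+1 -> nat) :
  computable f -> computable (fun e : ctx n.+2 => f (e.1.1, e.2)).
Proof.
move=> [rf rfP].
(* [lift ord0 ord0] is index 1, so these projections skip exactly the second input. *)
pose h (i : 'I_n.+1) := RProj (lift (lift ord0 ord0 : 'I_n.+2) i).
exists (RComp rf h) => v; case/tupleP: v => i v; case/tupleP: v => z v.
exists [tuple of i :: v] => [j|]; last exact: (rfP [tuple of i :: v]).
by rewrite /h /= !(tnth_nth 0) /=; case: (unliftP ord0 j) => [j'|] ->.
Qed.

Lemma computable_let n (a : ctx n -> nat) (f : ctx n.+1 -> nat) :
  computable a -> computable f -> computable (fun e : ctx n => f (e, a e)).
Proof.
move=> [ra raP] [rf rfP].
(* Input 0 is computed by [ra]; the remaining ones are passed on unchanged. *)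
pose h (i : 'I_n.+1) := if unlift ord0 i is Some j then RProj j else ra.
exists (RComp rf h) => v; exists [tuple of a (ctx_of n v) :: v].
  move=> i; rewrite /h; case: unliftP => [j|] -> /=; last exact: raP.
  by rewrite tnthS.
exact: (rfP [tuple of a (ctx_of n v) :: v]).
Qed.

Lemma computable_iteri n (k a : ctx n -> nat) (s : ctx n -> nat -> nat -> nat) :
  computable k -> computable a ->
  computable (fun e : ctx n.+2 => s e.1.1 e.2 e.1.2) ->
  computable (fun e => iteri (k e) (fun i z => s e i z) (a e)).
Proof.
move=> kC [ra raP] [rs rsP].
(* [RPrim] recurses on its first argument, so the number of rounds is first made a variable and [k]
   substituted afterwards. *)
suff prim : computable (fun e : ctx n.+1 => iteri e.2 (s e.1) (a e.1)).
  exact: computable_let kC prim.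
exists (RPrim ra rs) => v /=.
have -> : head 0 v = thead v by rewrite /thead (tnth_nth 0) nth0.
elim: (thead v) => [|x IH] /=; first exact: (raP [tuple of behead v]).
set z := iteri x _ _ in IH *; exists z; first exact: IH.
exact: (rsP [tuple of x :: z :: behead v]).
Qed.

Lemma computable_iter n (k a : ctx n -> nat) (s : ctx n -> nat -> nat) :
  computable k -> computable a ->
  computable (fun e : ctx n.+1 => s e.1 e.2) ->
  computable (fun e => iter (k e) (fun z => s e z) (a e)).
Proof.
move=> kC aC sC.
apply: (@computable_ext _ (fun e => iteri (k e) (fun _ z => s e z) (a e))).
  by move=> e; elim: (k e) => //= m ->.
by apply: computable_iteri => //; exact: (computable_weak sC).
Qed.

Lemma computable_var1 n : computable (fun e : ctx n.+2 => e.1.2).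
Proof. exact: (computable_weak (@computable_var0 _)). Qed.

Lemma computable_var2 n : computable (fun e : ctx n.+3 => e.1.1.2).
Proof. exact: (computable_weak (@computable_var1 _)). Qed.

Lemma computable_var3 n : computable (fun e : ctx n.+4 => e.1.1.1.2).
Proof. exact: (computable_weak (@computable_var2 _)). Qed.

Lemma computable_weak2 n f :
  computable f -> computable (fun e : ctx n.+2 => f e.1.1).
Proof. by move=> /computable_weak fC; exact: (computable_weak fC). Qed.

Lemma computable_weak3 n f :
  computable f -> computable (fun e : ctx n.+3 => f e.1.1.1).
Proof. by move=> /computable_weak2 fC; exact: (computable_weak fC). Qed.

Lemma computable_weak4 n f :
  computable f -> computable (fun e : ctx n.+4 => f e.1.1.1.1).
Proof. by move=> /computable_weak3 fC; exact: (computable_weak fC). Qed.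

Lemma computable_add n f g : computable f -> computable g ->
  computable (fun e : ctx n => f e + g e).
Proof.
move=> fC gC.
apply: (@computable_ext _ (fun e => iter (g e) (fun z => z.+1) (f e))).
  by move=> e; rewrite iter_succn.
by apply: computable_iter => //; apply/computable_succ/computable_var0.
Qed.

(** The last index handed out by [iteri] is the predecessor of the number of rounds. *)
Lemma computable_pred n f : computable f -> computable (fun e : ctx n => (f e).-1).
Proof.
move=> fC.
apply: (@computable_ext _ (fun e => iteri (f e) (fun i _ => i) 0)).
  by move=> e; case: (f e).
by apply: computable_iteri => //; [apply: computable_const|apply: computable_var0].
Qed.

Lemma computable_sub n f g : computable f -> computable g ->
  computable (fun e : ctx n => f e - g e).
Proof.
move=> fC gC.
apply: (@computable_ext _ (fun e => iter (g e) predn (f e))).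
  by move=> e; rewrite iter_predn.
by apply: computable_iter => //; apply/computable_pred/computable_var0.
Qed.

Lemma computable_mul n f g : computable f -> computable g ->
  computable (fun e : ctx n => f e * g e).
Proof.
move=> fC gC.
apply: (@computable_ext _ (fun e => iter (g e) (fun z => f e + z) 0)).
  by move=> e; rewrite iter_addn_0.
apply: computable_iter => //; first exact: computable_const.
by apply: computable_add (computable_var0 _); apply: computable_weak.
Qed.

Lemma computable_exp n f g : computable f -> computable g ->
  computable (fun e : ctx n => f e ^ g e).
Proof.
move=> fC gC.
apply: (@computable_ext _ (fun e => iter (g e) (fun z => f e * z) 1)).
  by move=> e; elim: (g e) => //= m ->; rewrite expnS.
apply: computable_iter => //; first exact: computable_const.
by apply: computable_mul (computable_var0 _); apply: computable_weak.
Qed.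

Lemma computable_negb n (p : ctx n -> bool) :
  computable (fun e => p e) -> computable (fun e => ~~ p e).
Proof.
move=> pC; apply: (@computable_ext _ (fun e => 1 - p e)).
  by move=> e; case: (p e).
exact: computable_sub (computable_const _ _) pC.
Qed.

Lemma computable_andb n (p q : ctx n -> bool) :
  computable (fun e => p e) -> computable (fun e => q e) ->
  computable (fun e => p e && q e).
Proof.
move=> pC qC; apply: computable_ext (computable_mul pC qC).
by move=> e; rewrite mulnb.
Qed.

Lemma computable_orb n (p q : ctx n -> bool) :
  computable (fun e => p e) -> computable (fun e => q e) ->
  computable (fun e => p e || q e).
Proof.
move=> /computable_negb pC /computable_negb qC.
apply: computable_ext (computable_negb (computable_andb pC qC)) => e /=.
by rewrite negb_and !negbK.
Qed.

Lemma computable_implb n (p q : ctx n -> bool) :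
  computable (fun e => p e) -> computable (fun e => q e) ->
  computable (fun e => p e ==> q e).
Proof.
move=> /computable_negb pC qC; apply: computable_ext (computable_orb pC qC) => e.
by rewrite implybE.
Qed.

Lemma computable_leq n f g : computable f -> computable g ->
  computable (fun e : ctx n => f e <= g e).
Proof.
move=> fC gC; apply: (@computable_ext _ (fun e => 1 - (f e - g e))).
  by move=> e; rewrite /leq; case: (f e - g e).
exact: computable_sub (computable_const _ _) (computable_sub fC gC).
Qed.

Lemma computable_eq n f g : computable f -> computable g ->
  computable (fun e : ctx n => f e == g e).
Proof.
move=> fC gC.
have := computable_andb (computable_leq fC gC) (computable_leq gC fC).
by apply: computable_ext => e; rewrite /= eqn_leq.
Qed.

(* The summand is a function on nat, so that unification can recover it. *)
Definition sum_below (k : nat) (f : nat -> nat) : nat := \sum_(i < k) f i.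

Lemma computable_sum n k (f : ctx n -> nat -> nat) : computable k ->
  computable (fun e : ctx n.+1 => f e.1 e.2) ->
  computable (fun e => sum_below (k e) (f e)).
Proof.
move=> kC fC.
apply: (@computable_ext _ (fun e => iteri (k e) (fun i z => z + f e i) 0)).
  move=> e; rewrite /sum_below.
  by elim: (k e) => [|m IH]; rewrite ?big_ord0 // big_ord_recr -IH.
apply: computable_iteri => //; first exact: computable_const.
apply: computable_add; first exact: computable_var1.
exact: (computable_weak_under fC).
Qed.

(** A bounded search succeeds iff the sum of the indicator values is nonzero. *)
Lemma computable_has n k (p : ctx n -> nat -> bool) : computable k ->
  computable (fun e : ctx n.+1 => p e.1 e.2) ->
  computable (fun e => has (p e) (iota 0 (k e))).
Proof.
move=> kC pC.
have sumC : computable (fun e => sum_below (k e) (fun i => p e i)).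
  exact: computable_sum.
have := computable_negb (computable_eq sumC (computable_const n 0)).
apply: computable_ext => e; congr nat_of_bool; rewrite /sum_below sum_nat_eq0 negb_forall.
apply/existsP/hasP => [[i]|[i]].
  by rewrite eqb0 negbK => pi; exists (val i); rewrite ?mem_iota /=.
by rewrite mem_iota => /= ik pi; exists (Ordinal ik); rewrite eqb0 negbK.
Qed.

Lemma computable_all n k (p : ctx n -> nat -> bool) : computable k ->
  computable (fun e : ctx n.+1 => p e.1 e.2) ->
  computable (fun e => all (p e) (iota 0 (k e))).
Proof.
move=> kC /computable_negb pC.
have := computable_negb (computable_has (p := fun e i => ~~ p e i) kC pC).
by apply: computable_ext => e; rewrite -all_predC; congr nat_of_bool;
  apply: eq_all => i; rewrite /= negbK.
Qed.

End Computability.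

Create HintDb computable discriminated.
#[local] Hint Constants Opaque : computable.
#[local] Hint Resolve computable_const computable_var0 computable_var1
  computable_var2 computable_var3 computable_weak computable_weak2
  computable_weak3 computable_weak4 computable_sum computable_has computable_all
  computable_negb computable_andb computable_orb computable_implb computable_eq
  computable_exp computable_mul computable_add computable_iter
  computable_succ : computable.

(** * Sequences coded by numbers *)

Section CodedSequences.

(* CodeSeq.code (k :: s) = 2 ^ k * (2 * CodeSeq.code s + 1), so in each of the
   next two sums at most one summand is nonzero. *)
Definition code_head (c : nat) : nat :=
  sum_below c (fun k => k * has (fun m => c == 2 ^ k * (m + m).+1) (iota 0 c)).

Definition code_tail (c : nat) : nat :=
  sum_below c (fun m => m * has (fun k => c == 2 ^ k * (m + m).+1) (iota 0 c)).

Definition code_nth (c i : nat) : nat := code_head (iter i code_tail c).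

(** The sum acts as a definite description: an indicator that holds at one index only picks out that
    index. *)
Lemma sum_unique k c (p : pred nat) :
  k < c -> (forall i, i < c -> p i = (i == k)) ->
  sum_below c (fun i => i * p i) = k.
Proof.
move=> kc pE; rewrite /sum_below (bigD1 (Ordinal kc)) //=.
rewrite pE // eqxx muln1 big1 ?addn0 //.
by move=> i /negPf ik; rewrite pE // -val_eqE /= in ik *; rewrite ik muln0.
Qed.

(** Every number is the code of its decoding, so both sides are codes of nonempty sequences, and
    coding is injective. *)
Lemma code_cons_inj k m k' m' :
  2 ^ k * (m + m).+1 = 2 ^ k' * (m' + m').+1 -> k = k' /\ m = m'.
Proof.
rewrite !addnn => km.
have /(can_inj CodeSeq.codeK)[-> mm] :
    CodeSeq.code (k :: CodeSeq.decode m) = CodeSeq.code (k' :: CodeSeq.decode m').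
  by rewrite /= !CodeSeq.decodeK.
by split=> //; rewrite -[m]CodeSeq.decodeK mm CodeSeq.decodeK.
Qed.

(** Head and tail are smaller than the code, so the sums and searches bounded by the code do find
    them. *)
Lemma code_cons_ltn k m :
  (k < 2 ^ k * (m + m).+1) * (m < 2 ^ k * (m + m).+1).
Proof.
split; first by rewrite (leq_trans (ltn_expl k (ltnSn 1))) // leq_pmulr.
by rewrite (leq_trans _ (leq_pmull _ _)) ?expn_gt0 // ltnS leq_addr.
Qed.

Lemma code_head_cons k s : code_head (CodeSeq.code (k :: s)) = k.
Proof.
rewrite /= -addnn; set m := CodeSeq.code s.
have [kc mc] := code_cons_ltn k m.
apply: sum_unique => // i ic; apply/hasP/eqP => [[j _ /eqP/code_cons_inj[]]|->] //.
by exists m; rewrite ?mem_iota.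
Qed.

Lemma code_tail_cons k s : code_tail (CodeSeq.code (k :: s)) = CodeSeq.code s.
Proof.
rewrite /= -addnn; set m := CodeSeq.code s.
have [kc mc] := code_cons_ltn k m.
apply: sum_unique => // i ic; apply/hasP/eqP => [[j _ /eqP/code_cons_inj[]]|->] //.
by exists k; rewrite ?mem_iota.
Qed.

(** Past the end this relies on the empty sequence having code 0, where both sums are empty; the
    result 0 agrees with the default of [nth]. *)
Lemma code_nthE s i : code_nth (CodeSeq.code s) i = nth 0 s i.
Proof.
rewrite /code_nth; elim: s i => [|k s IH] [|i].
- by rewrite /= /code_head /sum_below big_ord0.
- have -> : iter i.+1 code_tail (CodeSeq.code [::]) = 0.
    by elim: i => [|i IH]; rewrite iterS ?IH /code_tail /sum_below big_ord0.
  by rewrite /code_head /sum_below big_ord0.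
- by rewrite /= code_head_cons.
- by rewrite iterSr code_tail_cons IH.
Qed.

(** A further bit turns a code [m] into at most [4 * m + 2], which is less than [4 * m.+1]. *)
Lemma code_bits_ltn (s : bitseq) : CodeSeq.code (map nat_of_bool s) < 4 ^ size s.
Proof.
elim: s => //= b s IH; rewrite expnS -addnn.
by case: b; rewrite ?expn0 ?expn1; lia.
Qed.

End CodedSequences.

Lemma computable_code_head n (c : ctx n -> nat) :
  computable c -> computable (fun e => code_head (c e)).
Proof. by move=> cC; rewrite /code_head; auto 20 with computable. Qed.

Lemma computable_code_tail n (c : ctx n -> nat) :
  computable c -> computable (fun e => code_tail (c e)).
Proof. by move=> cC; rewrite /code_tail; auto 20 with computable. Qed.
#[local] Hint Resolve computable_code_head computable_code_tail : computable.

Lemma computable_code_nth n (c i : ctx n -> nat) : computable c -> computable i ->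
  computable (fun e => code_nth (c e) (i e)).
Proof. by move=> cC iC; rewrite /code_nth; auto 20 with computable. Qed.
#[local] Hint Resolve computable_code_nth : computable.

(** * The decider *)

Section Decider.
Implicit Types c : nat.

Definition letters c := code_nth c 0.
Definition states c := code_nth c 1.

(** The offset skips the two sizes and the table of [init]; the transition table is row-major, with
    one block of [states c * states c] entries per letter. *)
Definition trans_at c a p q :=
  code_nth c (2 + letters c + (a * (states c * states c) + (p * states c + q))).

Definition final_at c q :=
  code_nth c (2 + letters c + (letters c * (states c * states c) + q)).

Definition step_at c p q : bool :=
  has (fun a => has (fun x => (trans_at c a p x == q) || (trans_at c a x p == q))
    (iota 0 (states c))) (iota 0 (letters c)).

(* Reachability as membership in every step-closed set of states containing p;
   a set is given by the code of its characteristic sequence, below 4 ^ n. *)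
Definition connect_at c p q : bool :=
  all (fun S =>
    (code_nth S p != 0) &&
    all (fun u => all (fun v =>
      (code_nth S u != 0) && step_at c u v ==> (code_nth S v != 0))
      (iota 0 (states c))) (iota 0 (states c))
    ==> (code_nth S q != 0)) (iota 0 (4 ^ states c)).

Definition productive_at c q : bool :=
  has (fun f => (final_at c f != 0) && connect_at c q f) (iota 0 (states c)).

Definition recurrent_at c z : bool :=
  has (fun w => step_at c z w && connect_at c w z) (iota 0 (states c)).

Definition unbounded_at c y : bool :=
  has (fun z => recurrent_at c z && connect_at c z y) (iota 0 (states c)).

Definition fat_pattern_at c : bool :=
  has (fun a => has (fun x => has (fun y => has (fun r =>
    [&& (trans_at c a x y == r) || (trans_at c a y x == r), connect_at c r x,
        productive_at c r & unbounded_at c y])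
    (iota 0 (states c))) (iota 0 (states c))) (iota 0 (states c)))
    (iota 0 (letters c)).

Lemma computable_letters n (c : ctx n -> nat) :
  computable c ->
  computable (fun e => letters (c e)).
Proof. by move=> *; rewrite /letters; auto 20 with computable. Qed.
#[local] Hint Resolve computable_letters : computable.

Lemma computable_states n (c : ctx n -> nat) :
  computable c ->
  computable (fun e => states (c e)).
Proof. by move=> *; rewrite /states; auto 20 with computable. Qed.
#[local] Hint Resolve computable_states : computable.

Lemma computable_trans_at n (c a p q : ctx n -> nat) :
  computable c -> computable a -> computable p -> computable q ->
  computable (fun e => trans_at (c e) (a e) (p e) (q e)).
Proof. by move=> *; rewrite /trans_at; auto 20 with computable. Qed.
#[local] Hint Resolve computable_trans_at : computable.

Lemma computable_final_at n (c q : ctx n -> nat) :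
  computable c -> computable q ->
  computable (fun e => final_at (c e) (q e)).
Proof. by move=> *; rewrite /final_at; auto 20 with computable. Qed.
#[local] Hint Resolve computable_final_at : computable.

Lemma computable_step_at n (c p q : ctx n -> nat) :
  computable c -> computable p -> computable q ->
  computable (fun e => step_at (c e) (p e) (q e)).
Proof. by move=> *; rewrite /step_at; auto 20 with computable. Qed.
#[local] Hint Resolve computable_step_at : computable.

Lemma computable_connect_at n (c p q : ctx n -> nat) :
  computable c -> computable p -> computable q ->
  computable (fun e => connect_at (c e) (p e) (q e)).
Proof. by move=> *; rewrite /connect_at; auto 20 with computable. Qed.
#[local] Hint Resolve computable_connect_at : computable.

Lemma computable_productive_at n (c q : ctx n -> nat) :
  computable c -> computable q ->
  computable (fun e => productive_at (c e) (q e)).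
Proof. by move=> *; rewrite /productive_at; auto 20 with computable. Qed.
#[local] Hint Resolve computable_productive_at : computable.

Lemma computable_recurrent_at n (c q : ctx n -> nat) :
  computable c -> computable q ->
  computable (fun e => recurrent_at (c e) (q e)).
Proof. by move=> *; rewrite /recurrent_at; auto 20 with computable. Qed.
#[local] Hint Resolve computable_recurrent_at : computable.

Lemma computable_unbounded_at n (c q : ctx n -> nat) :
  computable c -> computable q ->
  computable (fun e => unbounded_at (c e) (q e)).
Proof. by move=> *; rewrite /unbounded_at; auto 20 with computable. Qed.
#[local] Hint Resolve computable_unbounded_at : computable.

Lemma computable_fat_pattern_at n (c : ctx n -> nat) :
  computable c -> computable (fun e => fat_pattern_at (c e)).
Proof. by move=> *; rewrite /fat_pattern_at; auto 20 with computable. Qed.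

End Decider.

(** * Correctness of the decider on automaton tables *)

Lemma nth_allpairs (S T : Type) (R : Type) (f : S -> T -> R) s t x0 y0 z0 i j :
  i < size s -> j < size t ->
  nth z0 [seq f x y | x <- s, y <- t] (i * size t + j) =
  f (nth x0 s i) (nth y0 t j).
Proof.
move=> + jt; elim: s i => //= x s IH [|i] si.
  by rewrite nth_cat size_map jt (nth_map y0).
rewrite nth_cat size_map mulSn -addnA ltnNge leq_addr /= addKn.
exact: IH.
Qed.

Section DeciderCorrect.
Variables (Sigma Q : finType) (A : tree_automaton Sigma Q).
Let c := automaton_code A.
Let num (T : finType) (x : T) : nat := enum_rank x.

Lemma has_iota_rank (T : finType) (p : pred nat) :
  has p (iota 0 #|T|) = [exists x : T, p (num x)].
Proof.
apply/hasP/existsP => [[i]|[x px]].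
  rewrite mem_iota /= => iT pi; exists (enum_val (Ordinal iT)).
  by rewrite /num enum_valK.
by exists (num x); rewrite // mem_iota /= ltn_ord.
Qed.

Lemma all_iota_rank (T : finType) (p : pred nat) :
  all p (iota 0 #|T|) = [forall x : T, p (num x)].
Proof.
apply/allP/forallP => [pT x|pT i]; first by rewrite pT // mem_iota /= ltn_ord.
rewrite mem_iota /= => iT; have := pT (enum_val (Ordinal iT)).
by rewrite /num enum_valK.
Qed.

Lemma num_eq (T : finType) (x y : T) : (num x == num y) = (x == y).
Proof. by rewrite /num val_eqE (inj_eq enum_rank_inj). Qed.

Lemma nth_enum_num (T : finType) x0 (x : T) : nth x0 (enum T) (num x) = x.
Proof. by rewrite /num -(enum_val_nth x0) enum_rankK. Qed.

Lemma ltn_num (T : finType) (x : T) : num x < size (enum T).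
Proof. by rewrite -cardE ltn_ord. Qed.

Lemma lettersE : letters c = #|Sigma|.
Proof. by rewrite /letters code_nthE. Qed.

Lemma statesE : states c = #|Q|.
Proof. by rewrite /states code_nthE. Qed.

Lemma trans_atE a p q : trans_at c (num a) (num p) (num q) = num (trans A a p q).
Proof.
rewrite /trans_at lettersE statesE code_nthE /automaton_table.
set qrs := [seq (q, r) | q <- enum Q, r <- enum Q].
have qrsE : size qrs = #|Q| * #|Q| by rewrite size_allpairs -!cardE.
have ltqr : num p * #|Q| + num q < size qrs.
  rewrite qrsE (@leq_trans ((num p).+1 * #|Q|)) ?leq_mul2r ?ltn_ord ?orbT //.
  by rewrite mulSn addnC ltn_add2r ltn_ord.
(* This skips the sizes and the table of [init]; next, the index is shown to fall before the table
   of [final]. *)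
rewrite -addnA add2n /= nth_cat size_map -cardE ltnNge leq_addr /= addKn.
rewrite nth_cat size_allpairs -cardE -qrsE ifT; last first.
  rewrite (@leq_trans ((num a).+1 * size qrs)) ?leq_mul2r ?ltn_ord ?orbT //.
  by rewrite mulSn addnC ltn_add2r.
rewrite (nth_allpairs _ a (p, p)) ?ltn_num // nth_enum_num.
have -> : nth (p, p) qrs (num p * #|Q| + num q) = (p, q).
  by rewrite /qrs cardE (nth_allpairs _ p p) ?ltn_num // !nth_enum_num.
by [].
Qed.

Lemma final_atE q : (final_at c (num q) != 0) = (q \in final A).
Proof.
rewrite /final_at lettersE statesE code_nthE /automaton_table.
rewrite -addnA add2n /= nth_cat size_map -cardE ltnNge leq_addr /= addKn.
rewrite nth_cat !size_allpairs -!cardE ltnNge leq_addr /= addKn.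
by rewrite (nth_map q) ?ltn_num // nth_enum_num; case: (q \in _).
Qed.

Lemma step_atE p q : step_at c (num p) (num q) = step A p q.
Proof.
rewrite /step_at lettersE statesE has_iota_rank; apply: eq_existsb => a.
rewrite has_iota_rank; apply: eq_existsb => x.
by rewrite !trans_atE !num_eq.
Qed.

Lemma connect_atE p q : connect_at c (num p) (num q) = connect (step A) p q.
Proof.
rewrite /connect_at statesE; apply/allP/idP => [closedP|/connectP[s sP ->] S _].
(* The set of states reachable from [p] is itself closed and contains [p]; its code is below the
   search bound, so the test applies to it. *)
- pose S := [seq connect (step A) p x | x <- enum Q].
  have SE x : code_nth (CodeSeq.code (map nat_of_bool S)) (num x) =
      connect (step A) p x.
    by rewrite code_nthE -map_comp (nth_map x) ?ltn_num //= nth_enum_num.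
  have := closedP (CodeSeq.code (map nat_of_bool S)).
  have Sn : size S = #|Q| by rewrite size_map -cardE.
  have := code_bits_ltn S; rewrite Sn mem_iota => S_lt /(_ S_lt).
  rewrite !SE connect0 /= all_iota_rank => /implyP.
  rewrite eqb0 negbK; apply; apply/forallP => u; rewrite all_iota_rank.
  apply/forallP => v; rewrite !SE step_atE !eqb0 !negbK.
  apply/implyP => /andP[pu uv].
  exact: connect_trans pu (connect1 uv).
(* Conversely, membership in a closed set propagates along the path from [p]. *)
- apply/implyP => /andP[+ /allP closedS].
  elim: s p sP => //= x s IH p /andP[px sP] pS; apply: IH => //.
  have mem_num (y : Q) : num y \in iota 0 #|Q| by rewrite mem_iota /= ltn_ord.
  have /allP /(_ _ (mem_num x)) := closedS _ (mem_num p).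
  by rewrite step_atE pS px.
Qed.

Lemma productive_atE q : productive_at c (num q) = productive A q.
Proof.
rewrite /productive_at statesE has_iota_rank; apply: eq_existsb => f.
by rewrite final_atE connect_atE.
Qed.

Lemma recurrent_atE z : recurrent_at c (num z) = recurrent A z.
Proof.
rewrite /recurrent_at statesE has_iota_rank; apply: eq_existsb => w.
by rewrite step_atE connect_atE.
Qed.

Lemma unbounded_atE y : unbounded_at c (num y) = unbounded A y.
Proof.
rewrite /unbounded_at statesE has_iota_rank; apply: eq_existsb => z.
by rewrite recurrent_atE connect_atE.
Qed.

Lemma fat_pattern_atE : fat_pattern_at c = fat_pattern A.
Proof.
rewrite /fat_pattern_at lettersE statesE has_iota_rank.
apply: eq_existsb => a; rewrite has_iota_rank; apply: eq_existsb => x.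
rewrite has_iota_rank; apply: eq_existsb => y; rewrite has_iota_rank.
apply: eq_existsb => r.
by rewrite !trans_atE !num_eq connect_atE productive_atE unbounded_atE.
Qed.

End DeciderCorrect.

Theorem theorem3p2 :
  (exists decider : recfun 1,
     forall (Sigma Q : finType) (A : tree_automaton Sigma Q),
       reduced A ->
       exists2 b : bool,
         computes decider [tuple automaton_code A] (nat_of_bool b) &
         if b then slim (recognised A) else fat (recognised A)) /\
  (forall (Sigma Q : finType) (A : tree_automaton Sigma Q),
     reduced A ->
     slim (recognised A) ->
     forall t : tree Sigma,
       recognised A t -> thickness_at_most (2 ^ (#|Q| - 1)) t).
Proof.
split.
(* The answer true stands for slim, that is, for the absence of the pattern. *)
- have [decider deciderP] := computable_negb
    (computable_fat_pattern_at (computable_var0 0)).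
  exists decider => Sigma Q A Ared; exists (~~ fat_pattern A).
    by rewrite -fat_pattern_atE; apply: deciderP.
  have [fatA|thinA] := boolP (fat_pattern A); first exact: fat_pattern_fat.
  exists (2 ^ (#|Q| - 1)); first by rewrite expn_gt0.
  by move=> t; apply: thickness_not_fat_pattern.
(* Pumping would make the language fat, so slimness rules out the pattern. *)
- move=> Sigma Q A Ared slimA t; apply: thickness_not_fat_pattern.
  by apply/negP => /(fat_pattern_fat Ared).
Qed.
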